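(* On the set of affine games, the relation $\sim$ is an equivalence relation, and the relation $\gtrsim$ is a partial order relation, where antisymmetry is understood with respect to $\sim$; that is, $\gtrsim$ is reflexive and transitive, and if $G\gtrsim H$ and $H\gtrsim G$ then $G\sim H$.
   Context: Affine games are defined recursively. There are two games without options, denoted $\infty$ and $\overline{\infty}$ (terminating games). Every other affine game is a form $G=\{G^{\mathcal L}\mid G^{\mathcal R}\}$, where $G^{\mathcal L}$ (Left options) and $G^{\mathcal R}$ (Right options) are non-empty finite sets of previously constructed affine games. Let $\mathbb A$ be the set of all affine games. Disjunctive sum: $G+H$ is undefined if one of $G,H$ is the form $\infty$ and the other is $\overline\infty$; it is $\infty$ if one is $\infty$ and the other is not $\overline\infty$; it is $\overline\infty$ if one is $\overline\infty$ and the other is not $\infty$; otherwise $G+H=\{G^{\mathcal L}+H,\,G+H^{\mathcal L}\mid G^{\mathcal R}+H,\,G+H^{\mathcal R}\}$. Outcomes: $o^L(G)=\mathbf L$ if $G=\infty$ or some $G^L\in G^{\mathcal L}$ has $o^R(G^L)=\mathbf L$, and $o^L(G)=\mathbf R$ otherwise; $o^R(G)=\mathbf R$ if $G=\overline\infty$ or some $G^R\in G^{\mathcal R}$ has $o^L(G^R)=\mathbf R$, and $o^R(G)=\mathbf L$ otherwise. With $\mathbf L>\mathbf R$, the outcome is $o(G)=(o^L(G),o^R(G))$, ordered componentwise. Relations: $G\sim H$ iff $o(G+X)=o(H+X)$ for all $X\in\mathbb A\setminus\{\infty,\overline\infty\}$; $G\gtrsim H$ iff $o(G+X)\geqslant o(H+X)$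 for all $X\in\mathbb A\setminus\{\infty,\overline\infty\}$. *)

(* Defs.v *)
(* MathComp, with finmap for finite sets over a choiceType. *)
From HB Require Import structures.
From mathcomp Require Import all_boot finmap.

Set Implicit Arguments.
Unset Strict Implicit.
Unset Printing Implicit Defensive.

Local Open Scope fset_scope.

(* {fset T} is not available inside the definition of T itself.  The type     *)
(* [game] of affine games is therefore carved out of the trees below, as the  *)
(* trees in which every list of options is non-empty and is the canonical     *)
(* enumeration of a finite set.  In terms of [game] only, [form], [gameP],    *)
(* [game_ind], [leftopts_form] and [rightopts_form] show that games are       *)
(* freely generated by two terminating games and by pairs of non-empty finite *)
(* sets, and [oLP], [oRP], [addP_*] are the recursive definitions of the      *)
(* outcomes and of the disjunctive sum.                                       *)
Inductive tree :=
  | TInf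
  | TNInf
  | TForm of seq tree & seq tree.

Definition tree_nested_ind (P : tree -> Prop) (Pinf : P TInf) (Pninf : P TNInf)
    (Pform : forall L R, foldr (fun x => and (P x)) True L ->
       foldr (fun x => and (P x)) True R -> P (TForm L R)) :=
  fix loop (G : tree) : P G :=
    let fix iter_conj (s : seq tree) : foldr (fun x => and (P x)) True s :=
      if s is x :: s' then conj (loop x) (iter_conj s') else I in
    match G with
    | TInf => Pinf
    | TNInf => Pninf
    | TForm L R => Pform L R (iter_conj L) (iter_conj R)
    end.

Fixpoint tree_encode (G : tree) : GenTree.tree bool :=
  match G with
  | TInf => GenTree.Leaf true
  | TNInf => GenTree.Leaf false
  | TForm L R => GenTree.Node 0
      [:: GenTree.Node 0 (map tree_encode L); GenTree.Node 0 (map tree_encode R)]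
  end.

Fixpoint tree_decode (t : GenTree.tree bool) : option tree :=
  match t with
  | GenTree.Leaf b => Some (if b then TInf else TNInf)
  | GenTree.Node _ [:: GenTree.Node _ l; GenTree.Node _ r] =>
      Some (TForm (pmap tree_decode l) (pmap tree_decode r))
  | _ => None
  end.

Lemma tree_encodeK : pcancel tree_encode tree_decode.
Proof.
elim/tree_nested_ind => //= L R IHL IHR; congr (Some (TForm _ _)).
- by elim: L IHL => //= x s IHs [-> /IHs /= ->].
- by elim: R IHR => //= x s IHs [-> /IHs /= ->].
Qed.

HB.instance Definition _ := Countable.copy tree (pcan_type tree_encodeK).

Lemma tree_mem_ind (P : tree -> Prop) :
  P TInf -> P TNInf ->
  (forall L R, {in L, forall x, P x} -> {in R, forall x, P x} ->
     P (TForm L R)) ->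
  forall G, P G.
Proof.
move=> P1 P2 P3.
have mem_conj s : foldr (fun x => and (P x)) True s -> {in s, forall x, P x}.
  elim: s => // y s IHs /= [Py /IHs Ps] x; rewrite inE => /predU1P[-> //|].
  exact: Ps.
by elim/tree_nested_ind => // L R /mem_conj IHL /mem_conj IHR; apply: P3.
Qed.

Fixpoint affine (G : tree) : bool :=
  match G with
  | TForm L R =>
      [&& L != [::], R != [::], canonical_keys L, canonical_keys R,
          all affine L & all affine R]
  | _ => true
  end.

Record game := Game { game_tree :> tree; _ : affine game_tree }.
HB.instance Definition _ := [isSub for game_tree].
HB.instance Definition _ := [Choice of game by <:].

Lemma game_tree_inj : injective game_tree.
Proof. exact: val_inj. Qed.

Definition infty : game := @Game TInf isT.
Definition ninfty : game := @Game TNInf isT.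

Definition terminal (G : game) : bool := (G == infty) || (G == ninfty).

Definition options (s : seq tree) : {fset game} := [fset x in pmap insub s].

Lemma mem_options (s : seq tree) (x : game) : (x \in options s) = (val x \in s).
Proof. by rewrite in_fset; exact: mem_pmap_sub. Qed.

Definition leftopts (G : game) : {fset game} :=
  if val G is TForm L _ then options L else fset0.

Definition rightopts (G : game) : {fset game} :=
  if val G is TForm _ R then options R else fset0.

Definition form_tree (L R : {fset game}) : tree :=
  TForm (sort_keys (map val L)) (sort_keys (map val R)).

Lemma form_subproof (L R : {fset game}) :
  L != fset0 -> R != fset0 -> affine (form_tree L R).
Proof.
have ne (A : {fset game}) : A != fset0 -> sort_keys (map val A) != [::].
  case/fset0Pn => x xA; apply/eqP => e.
  by have := mem_sort_keys (map_f val xA); rewrite e.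
have al (A : {fset game}) : all affine (sort_keys (map val A)).
  by apply/allP => x /mem_sort_keys_intro /mapP[y _ ->]; apply: (valP y).
by move=> L0 R0 /=; rewrite !ne // !canonical_sort_keys !al.
Qed.

Definition form (L R : {fset game}) (L0 : L != fset0) (R0 : R != fset0) : game :=
  Game (form_subproof L0 R0).

Lemma mem_sort_val (A : {fset game}) (x : game) :
  (val x \in sort_keys (map val A)) = (x \in A).
Proof.
apply/idP/idP => [/mem_sort_keys_intro|xA]; first by rewrite (mem_map val_inj).
by apply: mem_sort_keys; rewrite (mem_map val_inj).
Qed.

Lemma leftopts_form L R (L0 : L != fset0) (R0 : R != fset0) :
  leftopts (form L0 R0) = L.
Proof. by apply/fsetP => x; rewrite /leftopts /= mem_options mem_sort_val. Qed.

Lemma rightopts_form L R (L0 : L != fset0) (R0 : R != fset0) :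
  rightopts (form L0 R0) = R.
Proof. by apply/fsetP => x; rewrite /rightopts /= mem_options mem_sort_val. Qed.

Lemma infty_neq_ninfty : infty != ninfty.
Proof. by []. Qed.

Lemma form_nonterminal L R (L0 : L != fset0) (R0 : R != fset0) :
  ~~ terminal (form L0 R0).
Proof. by []. Qed.

Lemma options_fset0 (s : seq tree) :
  all affine s -> s != [::] -> options s != fset0.
Proof.
case: s => // t s /= /andP[ht _] _; apply/fset0Pn; exists (Game ht).
by rewrite mem_options mem_head.
Qed.

Lemma sort_options (s : seq tree) :
  all affine s -> canonical_keys s ->
  sort_keys (map val (options s)) = s.
Proof.
move=> /allP hs /eqP cs; rewrite -[RHS]cs; apply/eq_sort_keys => t.
apply/mapP/idP => [[x] | ts].
  by rewrite mem_options => xs ->.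
by exists (Game (hs _ ts)) => //; rewrite mem_options.
Qed.

Variant game_spec : game -> Prop :=
  | GameInf : game_spec infty
  | GameNInf : game_spec ninfty
  | GameForm L R (L0 : L != fset0) (R0 : R != fset0) : game_spec (form L0 R0).

Lemma gameP G : game_spec G.
Proof.
case: G => -[|| L R] hG.
- have -> : Game hG = infty by exact: game_tree_inj.
  exact: GameInf.
- have -> : Game hG = ninfty by exact: game_tree_inj.
  exact: GameNInf.
have /and5P[L0 R0 cL cR /andP[aL aR]] := hG.
have -> : Game hG = form (options_fset0 aL L0) (options_fset0 aR R0).
  by apply: game_tree_inj; rewrite /= /form_tree !sort_options.
exact: GameForm.
Qed.

Lemma game_ind (P : game -> Prop) :
  P infty -> P ninfty ->
  (forall L R (L0 : L != fset0) (R0 : R != fset0),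
     {in L, forall x, P x} -> {in R, forall x, P x} -> P (form L0 R0)) ->
  forall G, P G.
Proof.
move=> P1 P2 P3 [t]; elim/tree_mem_ind: t => [h|h|A B IHA IHB h].
- by have -> : Game h = infty by exact: game_tree_inj.
- by have -> : Game h = ninfty by exact: game_tree_inj.
have /and5P[L0 R0 cL cR /andP[aL aR]] := h.
have -> : Game h = form (options_fset0 aL L0) (options_fset0 aR R0).
  by apply: game_tree_inj; rewrite /= /form_tree !sort_options.
by apply: P3 => -[x hx]; rewrite mem_options => xs; [apply: IHA|apply: IHB].
Qed.

Inductive player := Left | Right.

Definition is_left (p : player) : bool := if p is Left then true else false.
Definition is_right (p : player) : bool := if p is Right then true else false.

(* [outcome_tree p G]: the winner when [p] moves first. *)
Fixpoint outcome_tree (p : player) (G : tree) : player :=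
  match p, G with
  | _, TInf => Left
  | _, TNInf => Right
  | Left, TForm L _ =>
      if has (fun x => is_left (outcome_tree Right x)) L then Left else Right
  | Right, TForm _ R =>
      if has (fun x => is_right (outcome_tree Left x)) R then Right else Left
  end.

Definition oL (G : game) : player := outcome_tree Left (val G).
Definition oR (G : game) : player := outcome_tree Right (val G).

Definition outcome (G : game) : player * player := (oL G, oR G).

Definition player_ge (p q : player) : Prop := p = Left \/ q = Right.

Definition outcome_ge (o1 o2 : player * player) : Prop :=
  player_ge o1.1 o2.1 /\ player_ge o1.2 o2.2.

Lemma oLP (G : game) :
  oL G = Left <-> G = infty \/ (exists2 GL, GL \in leftopts G & oR GL = Left).
Proof.
case: G / (gameP G) => [||L R L0 R0].
- by split; [left|].
- by split=> // -[//|[x]]; rewrite /leftopts /= inE.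
rewrite leftopts_form /oL /=; split.
  case: hasP => // -[t /mem_sort_keys_intro/mapP[x xL ->] hx] _; right.
  by exists x => //; rewrite /oR; case: outcome_tree hx.
case=> [/(congr1 val)//|[x xL hx]]; case: hasP => // -[].
by exists (val x); rewrite ?mem_sort_val // -/(oR x) hx.
Qed.

Lemma oRP (G : game) :
  oR G = Right <-> G = ninfty \/ (exists2 GR, GR \in rightopts G & oL GR = Right).
Proof.
case: G / (gameP G) => [||L R L0 R0].
- by split=> // -[//|[x]]; rewrite /rightopts /= inE.
- by split; [left|].
rewrite rightopts_form /oR /=; split.
  case: hasP => // -[t /mem_sort_keys_intro/mapP[x xR ->] hx] _; right.
  by exists x => //; rewrite /oL; case: outcome_tree hx.
case=> [/(congr1 val)//|[x xR hx]]; case: hasP => // -[].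
by exists (val x); rewrite ?mem_sort_val // -/(oL x) hx.
Qed.

(* [None] stands for an undefined sum.  In the last clause [pmap] discards    *)
(* nothing: a sum with a non-terminating summand is defined.                  *)
Fixpoint add_tree (G : tree) : tree -> option tree :=
  fix add_treeG (H : tree) : option tree :=
  match G, H with
  | TInf, TNInf | TNInf, TInf => None
  | TInf, _ | _, TInf => Some TInf
  | TNInf, _ | _, TNInf => Some TNInf
  | TForm GL GR, TForm HL HR => Some (TForm
      (sort_keys (pmap (fun x => add_tree x H) GL ++ pmap add_treeG HL))
      (sort_keys (pmap (fun x => add_tree x H) GR ++ pmap add_treeG HR)))
  end.

Lemma add_tree_formr G L R : exists K, add_tree G (TForm L R) = Some K.
Proof. by case: G => [||A B] /=; eexists. Qed.

Lemma add_tree_affine G H K :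
  affine G -> affine H -> add_tree G H = Some K -> affine K.
Proof.
elim/tree_mem_ind: G H K => [||GL GR IHGL IHGR].
- by move=> [||? ?] K //= _ _ [<-].
- by move=> [||? ?] K //= _ _ [<-].
elim/tree_mem_ind => [||HL HR IHHL IHHR] K; try by move=> _ _ [<-].
move=> hG hH.
have ne (s r : seq tree) : s != [::] ->
    sort_keys (pmap (fun x => add_tree x (TForm HL HR)) s ++ r) != [::].
  case: s => // x s _; have [y hy] := add_tree_formr x HL HR; apply/eqP => e.
  suff : y \in ([::] : seq tree) by [].
  by rewrite -e; apply: mem_sort_keys; rewrite mem_cat /= hy mem_head.
have /and5P[GL0 GR0 _ _ /andP[/allP aGL /allP aGR]] := hG.
have /and5P[_ _ _ _ /andP[/allP aHL /allP aHR]] := hH.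
case=> <-; apply/and5P; split; rewrite ?canonical_sort_keys //; last first.
  apply/andP; split; apply/allP => t /mem_sort_keys_intro; rewrite mem_cat !mem_pmap.
    case/orP => /mapP[x xs /esym hx].
      exact: (IHGL x xs (TForm HL HR) t (aGL _ xs) hH hx).
    exact: (IHHL x xs t hG (aHL _ xs) hx).
  case/orP => /mapP[x xs /esym hx].
    exact: (IHGR x xs (TForm HL HR) t (aGR _ xs) hH hx).
  exact: (IHHR x xs t hG (aHR _ xs) hx).
- exact: ne.
- exact: ne.
Qed.

Definition add (G H : game) : option game := obind insub (add_tree (val G) (val H)).

Lemma val_add G H : omap val (add G H) = add_tree (val G) (val H).
Proof.
rewrite /add; case e: (add_tree _ _) => [t|] //=.
by rewrite insubT // (add_tree_affine (valP G) (valP H) e).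
Qed.

Lemma addE G H K : add G H = Some K <-> add_tree (val G) (val H) = Some (val K).
Proof.
rewrite -val_add; case: (add G H) => [x|] //=; split=> [[->]//|[/game_tree_inj->]//].
Qed.

Lemma addP_undefined G H :
  add G H = None <->
  (G = infty /\ H = ninfty) \/ (G = ninfty /\ H = infty).
Proof.
split; last by case=> -[-> ->].
move=> e; have := val_add G H; rewrite e.
by case: G / (gameP G) {e} => [||? ? ? ?]; case: H / (gameP H) => [||? ? ? ?] //; auto.
Qed.

Lemma addP_infty G H :
  (G = infty /\ H <> ninfty) \/ (H = infty /\ G <> ninfty) ->
  add G H = Some infty.
Proof.
move=> h; apply/addE; case: h => -[->].
  by case: H / (gameP H).
by case: G / (gameP G).
Qed.

Lemma addP_ninfty G H :
  (G = ninfty /\ H <> infty) \/ (H = ninfty /\ G <> infty) ->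
  add G H = Some ninfty.
Proof.
move=> h; apply/addE; case: h => -[->].
  by case: H / (gameP H).
by case: G / (gameP G).
Qed.

Lemma add_defined G X : ~~ terminal X -> exists K, add G X = Some K.
Proof.
move=> hX; case e: (add G X) => [K|]; first by exists K.
by case/addP_undefined: e hX => -[_ ->]; rewrite /terminal eqxx ?orbT.
Qed.

Lemma addP_form G H : ~~ terminal G -> ~~ terminal H ->
  exists K, [/\ add G H = Some K, ~~ terminal K,
    forall X, X \in leftopts K <->
      (exists2 GL, GL \in leftopts G & add GL H = Some X) \/
      (exists2 HL, HL \in leftopts H & add G HL = Some X)
    & forall X, X \in rightopts K <->
      (exists2 GR, GR \in rightopts G & add GR H = Some X) \/
      (exists2 HR, HR \in rightopts H & add G HR = Some X)].
Proof.
case: G / (gameP G) => [||GL GR GL0 GR0] // _.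
case: H / (gameP H) => [||HL HR HL0 HR0] // _.
have [K eK] := add_defined (form GL0 GR0) (form_nonterminal HL0 HR0).
exists K; split => //.
- by move/addE: eK; case: K / (gameP K).
- move=> X; rewrite !leftopts_form /leftopts; move/addE: (eK) => /= -[<-].
  rewrite mem_options; split.
    move/mem_sort_keys_intro; rewrite mem_cat !mem_pmap.
    case/orP => /mapP[_ /mem_sort_keys_intro/mapP[x xs ->] /esym hx]; [left|right];
    by exists x => //; apply/addE.
  move=> h; apply: mem_sort_keys; rewrite mem_cat !mem_pmap.
  case: h => -[x xs /addE hx]; apply/orP; [left|right];
    by apply/mapP; exists (val x); rewrite ?mem_sort_val.
- move=> X; rewrite !rightopts_form /rightopts; move/addE: (eK) => /= -[<-].
  rewrite mem_options; split.
    move/mem_sort_keys_intro; rewrite mem_cat !mem_pmap.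
    case/orP => /mapP[_ /mem_sort_keys_intro/mapP[x xs ->] /esym hx]; [left|right];
    by exists x => //; apply/addE.
  move=> h; apply: mem_sort_keys; rewrite mem_cat !mem_pmap.
  case: h => -[x xs /addE hx]; apply/orP; [left|right];
    by apply/mapP; exists (val x); rewrite ?mem_sort_val.
Qed.

(* Both relations assert that the sums are defined, which always holds for    *)
(* non-terminating [X] by [add_defined].                                      *)
Definition sim (G H : game) : Prop :=
  forall X : game, ~~ terminal X ->
  exists GX HX, [/\ add G X = Some GX, add H X = Some HX
                  & outcome GX = outcome HX].

Definition gsim (G H : game) : Prop :=
  forall X : game, ~~ terminal X ->
  exists GX HX, [/\ add G X = Some GX, add H X = Some HX
                  & outcome_ge (outcome GX) (outcome HX)].

(* Main.v *)
Require Import Defs.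
From mathcomp Require Import all_boot.

(** For each fixed non-terminal [X], both relations compare only the outcomes of [G + X] and
    [H + X]: [sim] by equality, [gsim] by the componentwise order on pairs over the two-element
    chain [Left] > [Right]. That order is partial ([outcome_ge_refl], [outcome_ge_trans],
    [outcome_ge_antisym]), and its laws, like those of equality, survive pulling back along the sum
    with [X] and quantifying over [X]. Since addition is partial, the sums must also exist, which
    [add_defined] ensures. *)

Lemma player_ge_refl (p : player) : player_ge p p.
Proof. by case: p; [left|right]. Qed.

Lemma player_ge_trans (q p r : player) :
  player_ge p q -> player_ge q r -> player_ge p r.
Proof. by case=> [->|->]; [left|case=> // ->; right]. Qed.

Lemma player_ge_antisym (p q : player) :
  player_ge p q -> player_ge q p -> p = q.
Proof. by case: p; case: q => // -[] // _ []. Qed.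

Lemma outcome_ge_refl (o : player * player) : outcome_ge o o.
Proof. by split; exact: player_ge_refl. Qed.

Lemma outcome_ge_trans (o2 o1 o3 : player * player) :
  outcome_ge o1 o2 -> outcome_ge o2 o3 -> outcome_ge o1 o3.
Proof.
move=> [l12 r12] [l23 r23].
by split; [apply: player_ge_trans l12 l23 | apply: player_ge_trans r12 r23].
Qed.

Lemma outcome_ge_antisym (o1 o2 : player * player) :
  outcome_ge o1 o2 -> outcome_ge o2 o1 -> o1 = o2.
Proof.
case: o1 o2 => [l1 r1] [l2 r2] [/= l12 r12] [/= l21 r21].
by congr pair; exact: player_ge_antisym.
Qed.

Theorem theorem11 :
  [/\ (forall G : game, sim G G),
      (forall G H : game, sim G H -> sim H G)
    & (forall G H K : game, sim G H -> sim H K -> sim G K)]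
  /\
  [/\ (forall G : game, gsim G G),
      (forall G H K : game, gsim G H -> gsim H K -> gsim G K)
    & (forall G H : game, gsim G H -> gsim H G -> sim G H)].
Proof.
split; split.
(* Only the two reflexivity claims have to produce a sum; in the others the hypotheses supply it. *)
- by move=> G X /(add_defined G)[GX eG]; exists GX, GX.
- by move=> G H GH X /GH[GX [HX [eG eH o]]]; exists HX, GX.
- move=> G H K GH HK X X0.
  have [GX [HX [eG eH oGH]]] := GH X X0.
  have [HX' [KX [eH' eK oHK]]] := HK X X0.
  (* The two hypotheses give separate witnesses for [H + X]; they agree because [add] is a
     function. *)
  have [eHX] : Some HX = Some HX' by rewrite -eH.
  by exists GX, KX; split=> //; rewrite oGH eHX.
- move=> G X /(add_defined G)[GX eG]; exists GX, GX.
  by split=> //; exact: outcome_ge_refl.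
- move=> G H K GH HK X X0.
  have [GX [HX [eG eH oGH]]] := GH X X0.
  have [HX' [KX [eH' eK oHK]]] := HK X X0.
  have [eHX] : Some HX = Some HX' by rewrite -eH.
  exists GX, KX; split=> //; apply: outcome_ge_trans oGH _.
  by rewrite eHX.
- move=> G H GH HG X X0.
  have [GX [HX [eG eH oGH]]] := GH X X0.
  have [HX' [GX' [eH' eG' oHG]]] := HG X X0.
  have [eHX] : Some HX = Some HX' by rewrite -eH.
  (* In antisymmetry [G + X] also occurs twice, so its witnesses are identified as well. *)
  have [eGX] : Some GX = Some GX' by rewrite -eG.
  exists GX, HX; split=> //; apply: outcome_ge_antisym oGH _.
  by rewrite eGX eHX.
Qed.
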